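(* Let $S\subseteq([-1,1]\cup\{*\})^X$ be a real-valued hypothesis class and $B\subseteq\{-1,1,*\}^X$ a binary hypothesis class. For $\eta\ge0$ and $\varepsilon,\delta\in(0,1/2)$, letting $m:=\mathsf{VC}(S^{(0)}_\eta,B)$, \[ \#\mathsf{DCorM}(S,B,\varepsilon+2\eta,\delta)\le O\!\left(\frac m{\varepsilon^2}\log_+^2\!\left(\frac m\varepsilon\right)+\frac1{\varepsilon^2}\log\!\left(\frac1\delta\right)\right). \]
   Context: $X$ non-empty; hypotheses $h:X\to[-1,1]\cup\{*\}$; distributions discrete. For $\eta\ge0$, $h^{(0)}_\eta(x)=1$ if $h(x)\ne*$ and $h(x)>\eta$, $=-1$ if $h(x)\ne*$ and $h(x)<-\eta$, $=*$ otherwise; $S^{(0)}_\eta=\{s^{(0)}_\eta:s\in S\}$. Mutual VC dimension $\mathsf{VC}(H_1,H_2)$ of binary classes: sup of $|X'|$ over $X'\subseteq X$ shattered by both (shattered: every $\xi:X'\to\{-1,1\}$ agrees on $X'$ with some member). Generalized product: $u_1\diamondsuit u_2=u_1u_2$ if $u_2\in[-1,1]$, $=-|u_1|$ if $u_2=*$. Deterministic-label correlation maximization $\mathsf{DCorM}_n(S,B,\varepsilon,\delta)$: learners taking $n$ points in $X\times[-1,1]$ and outputting $f:X\to\{-1,1\}$ such that for every distribution $\mu$ on $X\times[-1,1]$ with $\Pr_\mu[s(x)=y]=1$ for some $s\in S$, given $n$ i.i.d. samples, with probability $\ge1-\delta$, $\mathbb{E}_\mu[yf(x)]\ge\sup_{b\in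 B}\mathbb{E}_\mu[y\diamondsuit b(x)]-\varepsilon$. $\#\mathsf{DCorM}$ is the least such $n$. $\log_+(u)=\log_2\max\{2,u\}$. *)

(* Defs.v *)
From HB Require Import structures.
From mathcomp Require Import all_boot all_order all_algebra.
From mathcomp Require Import all_classical all_reals all_analysis.
Set Implicit Arguments. Unset Strict Implicit. Unset Printing Implicit Defensive.
Import Order.TTheory GRing.Theory Num.Theory.
Local Open Scope classical_set_scope.
Local Open Scope ring_scope.

(* A (real-valued, possibly partial) hypothesis X -> [-1,1] \cup {*}:
   [None] encodes the symbol [*]. Binary hypotheses X -> {-1,1,*} use the
   same type with non-[*] values in {-1,1}. *)
Definition hyp (R : realType) (X : Type) := X -> option R.

Definition real_class (R : realType) (X : Type) (S : set (hyp R X)) :=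
  forall s x r, S s -> s x = Some r -> -1 <= r <= 1.

Definition binary_class (R : realType) (X : Type) (B : set (hyp R X)) :=
  forall b x r, B b -> b x = Some r -> r = 1 \/ r = -1.

Definition thresh0 (R : realType) (X : Type) (eta : R) (h : hyp R X) : hyp R X :=
  fun x => match h x with
           | Some r => if eta < r then Some 1
                       else if r < - eta then Some (-1) else None
           | None => None
           end.

Definition thresh0_class (R : realType) (X : Type) (eta : R) (S : set (hyp R X))
  : set (hyp R X) := [set thresh0 eta s | s in S].

Definition sgb (R : realType) (b : bool) : R := if b then 1 else -1.

(* A finite subset X' of size n of X is given as an injective map 'I_n -> X.
   It is shattered by H if every xi : X' -> {-1,1} agrees on X' with some
   member of H. *)
Definition shatters (R : realType) (X : Type) (H : set (hyp R X)) (n : nat)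
  (f : 'I_n -> X) : Prop :=
  forall xi : 'I_n -> bool, exists h, H h /\ forall i, h (f i) = Some (sgb R (xi i)).

(* [mutVC H1 H2 m]: the mutual VC dimension VC(H1,H2) equals the natural
   number m, i.e. m is the supremum of the sizes of finite sets shattered by
   both classes (with the convention sup of the empty set = 0). *)
Definition mutVC (R : realType) (X : Type) (H1 H2 : set (hyp R X)) (m : nat) : Prop :=
  (forall n (f : 'I_n -> X), injective f -> shatters H1 f -> shatters H2 f ->
     (n <= m)%N) /\
  (m = 0%N \/ exists f : 'I_m -> X, [/\ injective f, shatters H1 f & shatters H2 f]).

Definition discrete_dist (R : realType) (X : choiceType) (p : X * R -> R) : Prop :=
  [/\ forall z, 0 <= p z,
      forall z, p z != 0 -> -1 <= z.2 <= 1 &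
      (\esum_(z in [set: X * R]) (p z)%:E = 1)%E].

Definition expect (R : realType) (X : choiceType) (p : X * R -> R) (g : X * R -> R) : R :=
  fine (\esum_(z in [set: X * R]) (p z * Num.max (g z) 0)%:E) -
  fine (\esum_(z in [set: X * R]) (p z * Num.max (- g z) 0)%:E).

Definition gprod (R : realType) (u1 : R) (u2 : option R) : R :=
  match u2 with Some v => u1 * v | None => - `|u1| end.

Definition sample_prob (R : realType) (X : choiceType) (p : X * R -> R) (n : nat)
  (E : set {ffun 'I_n -> X * R}) : \bar R :=
  \esum_(zs in E) (\prod_(i < n) p (zs i))%:E.

(* A (deterministic) learner on n samples: outputs f : X -> {-1,1},
   encoded as a boolean function (true = 1, false = -1). *)
Definition learner (R : realType) (X : choiceType) (n : nat) :=
  {ffun 'I_n -> X * R} -> X -> bool.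

Definition DCorM (R : realType) (X : choiceType) (n : nat)
  (S B : set (hyp R X)) (eps delta : R) (L : learner R X n) : Prop :=
  forall p : X * R -> R, discrete_dist p ->
  (exists s, S s /\ forall z, p z != 0 -> s z.1 = Some z.2) ->
  ((1 - delta)%:E <=
    sample_prob p [set zs : {ffun 'I_n -> X * R} |
      ((expect p (fun z => z.2 * sgb R (L zs z.1)))%:E >=
        ereal_sup [set (expect p (fun z => gprod z.2 (b z.1)))%:E | b in B]
        - eps%:E)%E])%E.

Definition logp (R : realType) (u : R) : R := ln (Num.max 2 u) / ln 2.

(* Main.v *)
(* For [s] in [S] and [b] in [B], consider the partial hypothesis defined where
   the thresholded [s] agrees with [b]. A set shattered by these hypotheses is
   shattered by both classes, so their VC dimension is at most [m]. Boosting
   one-inclusion predictors (each trained on [16 m] points, in [4 l] rounds with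
   [n < 2 ^ l]) yields a majority vote that depends on at most [64 l m] sample
   points and is correct on all sample points where [b] agrees with the
   thresholded label. Such a vote has empirical correlation at least that of
   [b], up to [2 eta]: off the agreement set [b] earns [- |y|], or earns [|y|]
   with [|y| <= eta]. The learner outputs the vote with the largest empirical
   correlation; since each vote is a compression of the sample to few points,
   its empirical correlation is close to the true one by concentration on the
   remaining points and a union bound over the finitely many votes. *)
From HB Require Import structures.
From mathcomp Require Import all_boot.
From mathcomp Require Import zify.
From mathcomp Require Import boolp.
Set Implicit Arguments. Unset Strict Implicit. Unset Printing Implicit Defensive.

(** * Boosting the one-inclusion predictor *)

Section OneInclusion.
Variable I : finType.
Local Notation cube := {ffun I -> bool}.
Implicit Types (V : {set cube}) (D : {set I}) (f g xi : cube) (i j : I).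

Definition flip i f : cube := [ffun k => (k == i) (+) f k].

Definition cube_shatters V D :=
  forall xi, exists2 f, f \in V & {in D, f =1 xi}.

(** An edge of the one-inclusion graph in direction [i] is represented by its endpoint with value
    [false] at [i], so it is counted once. *)
Definition edges_along i V : {set cube} :=
  [set f in V | ~~ f i & flip i f \in V].

Lemma flipK i : involutive (flip i).
Proof. by move=> f; apply/ffunP => k; rewrite !ffunE addbA addbb. Qed.

Lemma flipC i j f : flip i (flip j f) = flip j (flip i f).
Proof. by apply/ffunP => k; rewrite !ffunE addbCA. Qed.

Lemma flip_same i f : flip i f i = ~~ f i.
Proof. by rewrite ffunE eqxx. Qed.

Lemma flip_other i j f : j != i -> flip i f j = f j.
Proof. by rewrite ffunE => /negbTE ->. Qed.

(** Induction on the number of active coordinates. Projecting out [i] splits [V] into halves [V0]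
    and [V1]: their union keeps dimension at most [m], their intersection loses one, and the
    intersection is exactly the set of edges along [i]. *)
Lemma one_inclusion_density V m :
  (forall D, cube_shatters V D -> #|D| <= m) ->
  \sum_i #|edges_along i V| <= m * #|V|.
Proof.
suff: forall n (A : {set I}) (W : {set cube}) k, #|A| = n ->
    (forall f, f \in W -> forall i, i \notin A -> f i = false) ->
    (forall D, cube_shatters W D -> #|D| <= k) ->
    \sum_i #|edges_along i W| <= k * #|W|.
  move=> /(_ #|I| setT V m) H vcV; apply: H => //; first exact: cardsT.
  by move=> f _ i; rewrite inE.
move=> {V m}; elim=> [|n IHn] A V m cA suppV vcV.
  rewrite big1 // => i _; apply: eq_card0 => f; rewrite !inE.
  apply/negbTE/negP => /and3P[_ fi Vf].
  have := suppV _ Vf i; rewrite (cards0_eq cA) inE => /(_ isT).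
  by rewrite flip_same (negbTE fi).
have [i iA] : exists i, i \in A by apply/set0Pn; rewrite -card_gt0 cA.
pose V0 := [set f in V | ~~ f i].
(* The upper half is moved to [f i = false], so that both halves live on [A :\ i]. *)
pose V1 := [set f : cube | ~~ f i & flip i f \in V].
have cV : #|V| = #|V0| + #|V1|.
  rewrite -(card_imset (mem V1) (can_inj (flipK i))) -cardsUI.
  rewrite [X in _ = _ + X](_ : _ = 0) ?addn0; last first.
    apply: eq_card0 => f; rewrite !inE; apply/negbTE/negP => /andP[/andP[_ fi]].
    by move=> /imsetP[g]; rewrite inE => /andP[gi _] fg; rewrite fg flip_same gi in fi.
  apply: eq_card => f; rewrite !inE; case fV: (f \in V) => /=.
    case fi: (f i) => //=; apply/esym/imsetP; exists (flip i f).
      by rewrite inE flip_same fi flipK fV.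
    by rewrite flipK.
  apply/esym/negbTE/negP => /imsetP[g]; rewrite inE => /andP[_ gV] fg.
  by rewrite fg gV in fV.
have cE j : j != i ->
    #|edges_along j V| <= #|edges_along j (V0 :|: V1)| + #|edges_along j (V0 :&: V1)|.
  move=> ji; apply: (@leq_trans (#|edges_along j V0| + #|edges_along j V1|)).
    rewrite -(card_imset (mem (edges_along j V1)) (can_inj (flipK i))).
    apply: leq_trans (leq_card_setU _ _); apply: subset_leq_card.
    apply/subsetP => f; rewrite !inE => /and3P[fV fj fV'].
    case fi: (f i); last by rewrite fV fj fV' flip_other ?fi 1?eq_sym.
    apply/orP; right; apply/imsetP; exists (flip i f); last by rewrite flipK.
    rewrite !inE flip_same fi (flip_other _ ji) fj (flipC i j) !flipK fV /=.
    by rewrite flip_other 1?eq_sym // flip_same fi fV'.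
  rewrite -cardsUI leq_add //; apply: subset_leq_card; apply/subsetP => f.
    rewrite !inE => /orP[] /and3P[] => [/andP[-> ->] -> /andP[-> ->]|] //=.
    by move=> /andP[-> ->] -> /andP[-> ->]; rewrite !orbT.
  by rewrite !inE => /andP[/and3P[/andP[-> ->] -> /andP[-> ->]] /and3P[/andP[_ ->] _ /andP[_ ->]]].
have supp01 f : f \in V0 :|: V1 -> forall j, j \notin A :\ i -> f j = false.
  rewrite !inE => fV j; rewrite !inE negb_and negbK => /orP[/eqP ->|jA].
    by case/orP: fV => /andP[] => [_ /negbTE|/negbTE].
  case/orP: fV => /andP[]; first by move=> fV _; exact: suppV jA.
  move=> _ /suppV /(_ _ jA); rewrite flip_other //.
  by apply: contraNneq jA => ->.
have cA' : #|A :\ i| = n by move: (cardsD1 i A); rewrite iA cA => -[].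
have notin (W : {set cube}) D : W \subset V0 :|: V1 -> cube_shatters W D -> i \notin D.
  move=> WU sD; apply/negP => iD.
  have [f fW /(_ i iD)] := sD [ffun=> true]; rewrite ffunE.
  by rewrite (supp01 f (fintype.subsetP WU _ fW)) // !inE eqxx.
have vcU D : cube_shatters (V0 :|: V1) D -> #|D| <= m.
  move=> sD; apply: vcV => xi; have [f fU fxi] := sD xi.
  have iD := notin _ _ (subxx _) sD.
  move: fU; rewrite !inE => /orP[] /andP[]; first by move=> fV _; exists f.
  move=> _ fV; exists (flip i f) => // j jD; rewrite flip_other ?fxi //.
  by apply: contraNneq iD => <-.
(* A member of the intersection extends both ways at [i], so a set shattered there can be enlarged
   by [i]. *)
have vcI D : cube_shatters (V0 :&: V1) D -> #|D| < m.
  move=> sD; have iD : i \notin D.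
    by apply: notin sD; apply: subset_trans (subsetIl _ _) (subsetUl _ _).
  have <- : #|i |: D| = #|D|.+1 by rewrite cardsU1 iD.
  apply: vcV => xi; have [f] := sD xi; rewrite !inE => /andP[/andP[fV fi] /andP[_ fV']] fxi.
  have ne j : j \in D -> j != i by apply: contraTneq => ->.
  case xii: (xi i).
    exists (flip i f) => // j; rewrite !inE => /orP[/eqP ->|jD].
      by rewrite flip_same fi xii.
    by rewrite flip_other ?ne // fxi.
  by exists f => // j; rewrite !inE => /orP[/eqP ->|/fxi //]; rewrite xii (negbTE fi).
have eI : edges_along i V = V0 :&: V1.
  by apply/setP => f; rewrite !inE; case: (f i); rewrite ?andbF ?andbT.
have EU := IHn _ _ _ cA' supp01 vcU.
(* The loss of one dimension leaves room for the edges along [i]. *)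
have EI : #|V0 :&: V1| + \sum_i #|edges_along i (V0 :&: V1)| <= m * #|V0 :&: V1|.
  have [->|/set0Pn[f fI]] := eqVneq (V0 :&: V1) set0.
    rewrite cards0 big1 // => j _; apply: eq_card0 => f; by rewrite !inE.
  have m0 : 0 < m by rewrite -(@cards0 I); apply: vcI => xi; exists f => // j; rewrite inE.
  (rewrite -[X in X * _](prednK m0) mulSn leq_add2l; apply: (IHn (A :\ i)) => //).
    by move=> g gI; apply: supp01; rewrite inE; move: gI; rewrite inE => /andP[->].
  by move=> D /vcI; rewrite -{1}(prednK m0) ltnS.
rewrite cV -cardsUI mulnDr (bigD1 i) //= eI.
have := leq_add EU EI; apply: leq_trans.
rewrite addnCA leq_add2l -big_split /= [leqRHS](bigD1 i) //=.
by apply: leq_trans (leq_addl _ _); apply: leq_sum => j /cE.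
Qed.

(* The density bound makes the one-inclusion graph 2m-degenerate: removing
   vertices of degree at most 2m one at a time and letting each edge predict the
   endpoint that survives longest costs a vertex at most 2m wrong predictions. *)
Lemma one_inclusion_predictor V m :
  (forall D, cube_shatters V D -> #|D| <= m) ->
  exists P : I -> cube -> bool,
    (forall i f, P i (flip i f) = P i f) /\
    (forall f, f \in V -> #|[set i | P i f != f i]| <= 2 * m).
Proof.
elim: {V}_.+1 {-2}V (ltnSn #|V|) => // n IHn V cV vcV.
have [->|V0] := eqVneq V set0; first by exists (fun _ _ => true); split => // f; rewrite inE.
(* If all degrees exceeded [2 * m], counting each edge at both endpoints would contradict the
   density bound. *)
have [v vV dv] : exists2 v, v \in V & #|[set i | flip i v \in V]| <= 2 * m.
  apply/exists_inP; apply: contraT; rewrite negb_exists_in => /forall_inP H.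
  have : #|V| * (2 * m).+1 <= \sum_(v in V) #|[set i | flip i v \in V]|.
    by rewrite -sum_nat_const; apply: leq_sum => v vV; rewrite ltnNge H.
  suff -> : \sum_(v in V) #|[set i | flip i v \in V]| = 2 * \sum_i #|edges_along i V|.
    have := one_inclusion_density vcV; move: V0; rewrite -card_gt0.
    by move: #|V| (\sum_i _) => a b; nia.
  under eq_bigr do rewrite -sum1dep_card big_mkcond /=.
  rewrite exchange_big big_distrr /=; apply: eq_bigr => i _.
  rewrite -big_mkcondr sum1dep_card mul2n -addnn.
  rewrite -{2}(card_imset (mem (edges_along i V)) (can_inj (flipK i))) -cardsUI.
  rewrite [X in _ + X](_ : _ = 0) ?addn0; last first.
    apply: eq_card0 => f; rewrite !inE; apply/negbTE/negP => /andP[/and3P[_ fi _]].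
    by move=> /imsetP[g]; rewrite inE => /and3P[_ gi _] fg; rewrite fg flip_same gi in fi.
  apply: eq_card => f; rewrite !inE; case fV: (f \in V) => /=; last first.
    apply/esym/negbTE/negP => /imsetP[g]; rewrite inE => /and3P[_ _ gV] fg.
    by rewrite fg gV in fV.
  case fi: (f i) => /=.
    case fV': (flip i f \in V).
      apply/esym/imsetP; exists (flip i f); last by rewrite flipK.
      by rewrite inE flip_same fi flipK fV fV'.
    apply/esym/negbTE/negP => /imsetP[g]; rewrite inE => /and3P[gV _ _] fg.
    by rewrite fg flipK gV in fV'.
  case fV': (flip i f \in V) => //=.
  apply/esym/negbTE/negP => /imsetP[g]; rewrite inE => /and3P[_ gi _] fg.
  by rewrite fg flip_same gi in fi.
have [|D sD|P [PI PV]] := IHn (V :\ v).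
- by move: cV; rewrite (cardsD1 v V) vV.
- apply: vcV => xi; have [f] := sD xi; rewrite inE => /andP[_ fV] fxi.
  by exists f.
(* An edge at [v] predicts the other endpoint if that lies in [V]: [v] errs only towards its
   neighbours, and they never err on these edges. *)
exists (fun i f => if (f == v) || (flip i f == v)
                   then (if flip i v \in V then ~~ v i else v i) else P i f).
split=> [i f|f fV]; first by rewrite flipK PI orbC.
have [->|fv] := eqVneq f v.
  apply: leq_trans dv; apply: subset_leq_card; apply/subsetP => i; rewrite !inE /=.
  by case: ifP => //; rewrite eqxx.
apply: leq_trans (PV f _); last by rewrite !inE fv.
apply: subset_leq_card; apply/subsetP => i; rewrite !inE /=.
case: (flip i f =P v) => [e|//]; rewrite -e flipK fV flip_same negbK eqxx //.
Qed.

End OneInclusion.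

(* AdaBoost with integer weights: a point doubles its weight whenever it is
   misclassified, so the total weight grows by a factor at most 9/8 per round. *)
Lemma boosting (I : finType) (A : Type) (correct : A -> I -> bool) (l : nat) :
  (forall w : I -> nat,
     exists a, 8 * \sum_(i | ~~ correct a i) w i <= \sum_i w i) ->
  #|I| < 2 ^ l ->
  exists s : (4 * l).-tuple A,
    forall i, 2 * count (fun a => ~~ correct a i) s < 4 * l.
Proof.
move=> weak ltI.
have rounds K : exists2 s : seq A, size s = K &
    8 ^ K * \sum_i 2 ^ count (fun a => ~~ correct a i) s <= 9 ^ K * #|I|.
  elim: K => [|K [s sK IH]].
    by exists [::] => //=; rewrite sum1_card.
  have [a wa] := weak (fun i => 2 ^ count (fun a => ~~ correct a i) s).
  exists (a :: s) => /=; first by rewrite sK.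
  under eq_bigr => i _ do rewrite expnD.
  rewrite (_ : \sum_i _ = \sum_i 2 ^ count (fun a => ~~ correct a i) s +
      \sum_(i | ~~ correct a i) 2 ^ count (fun a => ~~ correct a i) s); last first.
    rewrite [X in _ + X]big_mkcond -big_split; apply: eq_bigr => i _ /=.
    by case: (correct a i) => /=; lia.
  rewrite !expnS; move: wa IH.
  move: (\sum_i _) (\sum_(i | _) _) (8 ^ K) (9 ^ K) => W E a8 a9 wa IH.
  have h : a8 * (8 * E) <= a8 * W by rewrite leq_mul2l wa orbT.
  by move: #|I| IH => c IH; clear wa; nia.
have [s sK sW] := rounds (4 * l).
exists (Tuple (introT eqP sK)) => i /=; rewrite ltnNge; apply/negP => ge.
set e := count _ s in ge.
(* A point missed in at least half of the [4 * l] rounds has this weight on its own. *)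
have : 2 ^ (2 * l) <= \sum_i 2 ^ count (fun a => ~~ correct a i) s.
  rewrite (bigD1 i) //=; apply: leq_trans (leq_addr _ _).
  by rewrite leq_exp2l //; lia.
rewrite -(leq_pmul2l (_ : 0 < 8 ^ (4 * l))) ?expn_gt0 // => /leq_trans /(_ sW).
have : 9 ^ (4 * l) * #|I| < 9 ^ (4 * l) * 2 ^ l by rewrite ltn_pmul2l ?expn_gt0.
move=> lt le; have := leq_ltn_trans le lt.
(* The contradiction is [9 ^ 4 * 2 = 13122 < 16384 = 8 ^ 4 * 2 ^ 2], raised to the power [l]. *)
rewrite (expnM 8) (expnM 9) (expnM 2) -!expnMn ltn_exp2r //.
by case: (l) lt => [|//]; rewrite muln0 !expn0; case: #|I| (fintype0 i).
Qed.

(** * Insertion and removal of one coordinate of a tuple *)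

Section Insertion.
Variables (d : nat) (T : Type) (j : 'I_d.+1).

Definition insert (x : T) (u : {ffun 'I_d -> T}) : {ffun 'I_d.+1 -> T} :=
  [ffun k => if unlift j k is Some k' then u k' else x].

Definition remove (u : {ffun 'I_d.+1 -> T}) : {ffun 'I_d -> T} :=
  [ffun k => u (lift j k)].

Lemma insert_at x u : insert x u j = x.
Proof. by rewrite ffunE unlift_none. Qed.

Lemma insert_lift x u k : insert x u (lift j k) = u k.
Proof. by rewrite ffunE liftK. Qed.

Lemma insertK x u : remove (insert x u) = u.
Proof. by apply/ffunP => k; rewrite ffunE insert_lift. Qed.

Lemma removeK (u : {ffun 'I_d.+1 -> T}) : insert (u j) (remove u) = u.
Proof.
by apply/ffunP => k; rewrite ffunE; case: unliftP => [k'|] ->; rewrite ?ffunE.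
Qed.

End Insertion.

Lemma sum_insert (d : nat) (T : finType) (j : 'I_d.+1) (F : {ffun 'I_d.+1 -> T} -> nat) :
  \sum_u F u = \sum_(u : {ffun 'I_d -> T}) \sum_x F (insert j x u).
Proof.
rewrite pair_big /=.
rewrite (reindex (fun p : {ffun 'I_d -> T} * T => insert j p.2 p.1)) //=.
exists (fun u => (remove j u, u j)) => [[u x]|u] _ /=.
  by rewrite insertK insert_at.
exact: removeK.
Qed.

(** * Weak learners and majority votes for a partial class *)

Section PartialClass.
Variables (X : Type) (H : (X -> option bool) -> Prop) (m : nat).
Hypothesis vcH : forall k (x : 'I_k -> X), injective x ->
  (forall xi : 'I_k -> bool, exists2 h, H h & forall i, h (x i) = Some (xi i)) ->
  k <= m.

Definition patterns N (x : {ffun 'I_N -> X}) : {set {ffun 'I_N -> bool}} :=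
  [set xi : {ffun 'I_N -> bool} |
     `[< exists2 h, H h & forall i, h (x i) = Some (xi i) >]].

(** Shattering separates any two coordinates of [D], so they carry distinct points and [x] is
    injective on [D], even if it repeats points elsewhere. *)
Lemma patterns_vc N (x : {ffun 'I_N -> X}) D :
  cube_shatters (patterns x) D -> #|D| <= m.
Proof.
move=> sD; apply: (vcH (x := x \o enum_val)) => [a b /= eab|xi].
  apply/eqP/negPn/negP => nab.
  have [f] := sD [ffun k => k == enum_val a]; rewrite inE => /asboolP[h _ hf] fa.
  have := hf (enum_val b); rewrite -eab hf !fa ?enum_valP // !ffunE eqxx => -[].
  by rewrite (inj_eq enum_val_inj) eq_sym (negbTE nab).
have [f] := sD [ffun k => [exists a, (enum_val a == k) && xi a]].
rewrite inE => /asboolP[h Hh hf] fD; exists h => // i /=.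
rewrite hf fD ?enum_valP // ffunE; congr Some; apply/existsP/idP => [[a]|xii].
  by rewrite (inj_eq enum_val_inj) => /andP[/eqP ->].
by exists i; rewrite eqxx.
Qed.

Definition leave_one_out N (x : {ffun 'I_N -> X}) :
    'I_N -> {ffun 'I_N -> bool} -> bool :=
  sval (cid (one_inclusion_predictor (@patterns_vc N x))).

Section Weak.
Variable d : nat.

(** The label [false] is a placeholder, since the prediction at [j] ignores the label at [j]. The
    position [j] is left free, to be chosen by averaging. *)
Definition weak (j : 'I_d.+1) (u : {ffun 'I_d -> X * bool}) (x : X) : bool :=
  let v := insert j (x, false) u in
  leave_one_out [ffun k => (v k).1] j [ffun k => (v k).2].

Lemma weak_mistakes (v : {ffun 'I_d.+1 -> X * bool}) h :
  H h -> (forall k, h (v k).1 = Some (v k).2) ->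
  \sum_j (weak j (remove j v) (v j).1 != (v j).2) <= 2 * m.
Proof.
move=> Hh hv; pose x := [ffun k => (v k).1]; pose f := [ffun k => (v k).2].
have fV : f \in patterns x.
  by rewrite inE; apply/asboolP; exists h => // i; rewrite !ffunE.
have [PI PV] : (forall i g, leave_one_out x i (flip i g) = leave_one_out x i g) /\
    (forall g, g \in patterns x -> #|[set i | leave_one_out x i g != g i]| <= 2 * m).
  exact: svalP (cid (one_inclusion_predictor (@patterns_vc _ x))).
apply: leq_trans (PV f fV); rewrite -sum1dep_card [leqRHS]big_mkcond /=.
apply: leq_sum => j _; rewrite /weak.
have -> : [ffun k => (insert j ((v j).1, false) (remove j v) k).1] = x.
  by apply/ffunP => k; rewrite !ffunE; case: unliftP => [k'|] -> //; rewrite ffunE.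
(* [g] is [f] with the label at [j] replaced by [false], hence either [f] or [flip j f]. *)
set g := [ffun k => _]; have -> : leave_one_out x j g = leave_one_out x j f.
  have [ff|ft] := boolP (f j).
    rewrite -[RHS]PI; congr leave_one_out; apply/ffunP => k.
    rewrite !ffunE; case: unliftP => [k'|] ->.
      by rewrite ffunE eq_sym (negbTE (neq_lift _ _)).
    by rewrite eqxx; move: ff; rewrite ffunE => ->.
  congr leave_one_out; apply/ffunP => k.
  rewrite !ffunE; case: unliftP => [k'|] ->; first by rewrite ffunE.
  by move: ft; rewrite ffunE => /negbTE ->.
by rewrite [f j]ffunE; case: eqP.
Qed.

End Weak.

(* Averaging the leave-one-out bound over all (16m+1)-tuples, weighted by the
   product weights, yields a position and a training tuple with error <= 1/8. *)
Lemma weak_learner n (z : {ffun 'I_n -> X * bool}) h (w : 'I_n -> nat) :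
  H h -> 0 < n ->
  exists a : 'I_(16 * m).+1 * {ffun 'I_(16 * m) -> 'I_n},
    8 * \sum_(i | (h (z i).1 == Some (z i).2) &&
                  (weak a.1 [ffun k => z (a.2 k)] (z i).1 != (z i).2)) w i
    <= \sum_(i | h (z i).1 == Some (z i).2) w i.
Proof.
(* At most [2 * m] mistakes in [16 * m + 1] positions make an error rate below 1/8. *)
move=> Hh n0; set d := 16 * m; set T := fun i => h (z i).1 == Some (z i).2.
pose wt i := if T i then w i else 0.
pose wrong (j : 'I_d.+1) (t : {ffun 'I_d -> 'I_n}) i : bool :=
  weak j [ffun k => z (t k)] (z i).1 != (z i).2.
pose W := \sum_i wt i.
suff [a Ha] : exists a : 'I_d.+1 * {ffun 'I_d -> 'I_n},
    8 * \sum_i wt i * wrong a.1 a.2 i <= W.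
  exists a; move: Ha; rewrite /W /wt -big_mkcond /=; congr (8 * _ <= _).
  rewrite [RHS]big_mkcondr big_mkcond [RHS]big_mkcond /=; apply: eq_bigr => i _.
  rewrite -/(T i) /wrong; case: (T i) => //.
  by case: (weak _ _ _ != _); rewrite ?muln1 ?muln0.
have [W0|Wpos] := posnP W.
  exists (ord0, [ffun=> Ordinal n0]).
  rewrite big1 // => i _; apply/eqP; rewrite muln_eq0; apply/orP; left.
  by rewrite -leqn0 -W0 /W (bigD1 i) //= leq_addr.
apply: contrapT => /forallNP contra.
pose prodw N (r : {ffun 'I_N -> 'I_n}) := \prod_k wt (r k).
have prodwE N : \sum_r prodw N r = W ^ N.
  rewrite /prodw -(bigA_distr_bigA (fun (_ : 'I_N) i => wt i)).
  by rewrite prod_nat_const card_ord.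
pose total := \sum_j \sum_r prodw d.+1 r * wrong j (remove j r) (r j).
have upper : total <= W ^ d.+1 * (2 * m).
  rewrite /total exchange_big /= -prodwE big_distrl /=; apply: leq_sum => r _.
  rewrite -big_distrr /=.
  have [rT|] := boolP [forall k, T (r k)].
    rewrite leq_mul2l; apply/orP; right.
    apply: leq_trans (weak_mistakes (v := [ffun k => z (r k)]) Hh _); last first.
      by move=> k; rewrite ffunE; apply/eqP/(forallP rT).
    apply: leq_sum => j _; rewrite /wrong ffunE.
    rewrite (_ : [ffun k => z (remove j r k)] = remove j [ffun k => z (r k)]) //.
    by apply/ffunP => k; rewrite !ffunE.
  rewrite negb_forall => /existsP[k kT].
  by rewrite /prodw (bigD1 k) //= /wt (negbTE kT) !mul0n.
(* Every position and training tuple is assumed to have error above [W / 8]; coordinate [j] of the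
   long tuple serves as the test point. *)
have lower : d.+1 * (W ^ d * W.+1) <= 8 * total.
  rewrite -[d.+1]card_ord -sum_nat_const /total big_distrr /=; apply: leq_sum => j _.
  rewrite (sum_insert j) -prodwE big_distrl big_distrr /=; apply: leq_sum => t _.
  rewrite (_ : \sum_x _ = prodw d t * \sum_i wt i * wrong j t i).
    by rewrite mulnCA leq_mul2l ltnNge; apply/orP; right; apply/negP/(contra (j, t)).
  rewrite big_distrr /=; apply: eq_bigr => i _.
  rewrite insertK insert_at mulnA; congr (_ * _).
  rewrite /prodw (bigD1_ord j) //= insert_at mulnC; congr (_ * _).
  by apply: eq_bigr => k _; rewrite insert_lift.
have := leq_trans lower (leq_mul (leqnn 8) upper); rewrite expnS /d.
have : 0 < W ^ (16 * m) by rewrite expn_gt0 Wpos.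
by move: (W ^ _) => P; nia.
Qed.

Local Notation round n := ('I_(16 * m).+1 * {ffun 'I_(16 * m) -> 'I_n})%type.

(** [s] stores only indices into the sample, so the votes for given [n] and [l] form a finite family
    fixed before the sample is seen. *)
Definition vote n l (s : (4 * l).-tuple (round n)) (z : {ffun 'I_n -> X * bool})
    (x : X) : bool :=
  4 * l < 2 * count (fun a : round n => weak a.1 [ffun k => z (a.2 k)] x) s.

Lemma vote_consistent n l (z : {ffun 'I_n -> X * bool}) h :
  H h -> 0 < n -> n < 2 ^ l ->
  exists s, forall i, h (z i).1 = Some (z i).2 -> @vote n l s z (z i).1 = (z i).2.
Proof.
move=> Hh n0 nl; pose A := round n.
(* Points where [h] does not give the label count as correct and so never gain weight. *)
pose correct (a : A) i := (h (z i).1 == Some (z i).2) ==>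
  (weak a.1 [ffun k => z (a.2 k)] (z i).1 == (z i).2).
have wl w : exists a : A, 8 * \sum_(i | ~~ correct a i) w i <= \sum_i w i.
  have [a aP] := weak_learner z w Hh n0; exists a.
  apply: (@leq_trans (\sum_(i | h (z i).1 == Some (z i).2) w i)).
    by apply: leq_trans aP; rewrite (eq_bigl _ _ (fun i => negb_imply _ _)).
  by rewrite [leqRHS](bigID (fun i => h (z i).1 == Some (z i).2)) leq_addr.
have [|s sP] := boosting (l := l) wl; first by rewrite card_ord.
exists s => i /eqP hi; have := sP i; rewrite /vote /correct hi /=.
have := count_predC (fun a : A => weak a.1 [ffun k => z (a.2 k)] (z i).1) s.
set p := fun a : A => weak a.1 [ffun k => z (a.2 k)] (z i).1.
rewrite size_tuple -/p; case: (z i).2.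
  have -> : count (fun a : A => ~~ (p a == true)) s = count (predC p) s.
    by apply: eq_count => a /=; rewrite eqb_id.
  by move: (count p s) (count (predC p) s) => a b; lia.
have -> : count (fun a : A => ~~ (p a == false)) s = count p s.
  by apply: eq_count => a /=; rewrite eqbF_neg negbK.
by move: (count p s) (count (predC p) s) => a b; lia.
Qed.

End PartialClass.
Require Import Defs.
From mathcomp Require Import all_order all_algebra.
From mathcomp Require Import all_classical all_reals all_analysis.
From mathcomp Require Import ring lra.

Import Order.TTheory GRing.Theory Num.Theory.
Local Open Scope classical_set_scope.
Local Open Scope ring_scope.

(** * Uniform deviations *)

(** One inequality is checked on finite partial sums; the reverse is the same inequality for
    [c^-1]. *)
Lemma esumZl (R : realType) (T : choiceType) (I : set T) (c : R) (a : T -> \bar R) :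
  0 <= c -> (forall i, 0 <= a i)%E ->
  (\esum_(i in I) (c%:E * a i) = c%:E * \esum_(i in I) a i)%E.
Proof.
have le_Zl (d : R) (b : T -> \bar R) : 0 <= d -> (forall i, 0 <= b i)%E ->
    (\esum_(i in I) (d%:E * b i) <= d%:E * \esum_(i in I) b i)%E.
  move=> d0 b0; apply: ge_ereal_sup => _ [Y [finY YI]] <-.
  rewrite -ge0_mule_fsumr; last by exact: b0.
  by apply: lee_wpmul2l; [rewrite lee_fin | apply: esum_ge; exists Y].
rewrite le_eqVlt => /predU1P[<-|c0] a0.
  by rewrite mul0e esum1 // => i _; rewrite mul0e.
apply/eqP; rewrite eq_le (le_Zl _ _ (ltW c0) a0) /=.
have -> : (\esum_(i in I) a i = \esum_(i in I) (c^-1%:E * (c%:E * a i)))%E.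
  by apply: eq_esum => i _; rewrite muleA -EFinM mulVf ?gt_eqF // mul1e.
have ca0 i : (0 <= c%:E * a i)%E by rewrite mule_ge0 // lee_fin ltW.
have : (\esum_(i in I) (c^-1%:E * (c%:E * a i)) <=
        c^-1%:E * \esum_(i in I) (c%:E * a i))%E.
  by apply: le_Zl => //; rewrite invr_ge0 ltW.
have c0' : (0 <= c%:E)%E by rewrite lee_fin ltW.
by move=> /(lee_wpmul2l c0'); rewrite [leRHS]muleA -EFinM mulfV ?gt_eqF // mul1e.
Qed.

Lemma esum_insert (R : realType) (Z : choiceType) n (j : 'I_n.+1)
    (F : {ffun 'I_n.+1 -> Z} -> \bar R) :
  (forall u, 0 <= F u)%E ->
  (\esum_(u in [set: {ffun 'I_n.+1 -> Z}]) F u =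
   \esum_(v in [set: {ffun 'I_n -> Z}]) \esum_(z in [set: Z]) F (insert j z v))%E.
Proof.
move=> F0; rewrite (esum_esum (J := fun=> setT)) //.
apply: (@reindex_esum _ _ _ _ _ (fun p : {ffun 'I_n -> Z} * Z => insert j p.2 p.1)).
split => [p _ //|[v z] [v' z'] _ _ /= e|u _].
  by rewrite -(insertK j z v) e insertK -(insert_at j z v) e insert_at.
by exists (remove j u, u j) => //=; rewrite removeK.
Qed.

(** * Independent draws from a discrete distribution *)

Section Sampling.
Variables (R : realType) (Z : choiceType) (p : Z -> R).
Hypotheses (p0 : forall z, 0 <= p z)
  (p1 : (\esum_(z in [set: Z]) (p z)%:E = 1)%E).

Lemma esum_mulp (c : R) : 0 <= c ->
  (\esum_(z in [set: Z]) (c * p z)%:E = c%:E)%E.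
Proof.
by move=> c0; rewrite -[RHS]mule1 -p1 -esumZl.
Qed.

Lemma prod_insert n (j : 'I_n.+1) z (v : {ffun 'I_n -> Z}) :
  \prod_i p (insert j z v i) = (\prod_i p (v i)) * p z.
Proof.
rewrite (bigD1_ord j) //= insert_at mulrC; congr (_ * _).
by apply: eq_bigr => k _; rewrite insert_lift.
Qed.

Lemma sample_total n :
  (\esum_(u in [set: {ffun 'I_n -> Z}]) (\prod_i p (u i))%:E = 1)%E.
Proof.
elim: n => [|n IHn].
  have u0 : {ffun 'I_0 -> Z} by apply: finfun => -[].
  have -> : [set: {ffun 'I_0 -> Z}] = [set u0].
    by apply/seteqP; split => // u _; apply/ffunP => -[].
  by rewrite esum_set1 ?big_ord0 ?lee_fin.
rewrite (esum_insert ord0) => [|u]; last by rewrite lee_fin prodr_ge0.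
rewrite -IHn; apply: eq_esum => v _.
under eq_esum do rewrite prod_insert.
by rewrite esum_mulp // prodr_ge0.
Qed.

(* Summing out the coordinates of [C] one at a time: each of them is, given the
   others, an independent draw from [p], and contributes a factor at most 1. *)
Lemma esum_prod_le1 (z0 : Z) n (C : {set 'I_n}) (phi : {ffun 'I_n -> Z} -> Z -> R) :
  (forall u z, 0 <= phi u z) ->
  (forall u u' : {ffun 'I_n -> Z}, (forall i, i \notin C -> u i = u' i) -> phi u = phi u') ->
  (forall u, (\esum_(z in [set: Z]) (p z * phi u z)%:E <= 1)%E) ->
  (\esum_(u in [set: {ffun 'I_n -> Z}])
     ((\prod_i p (u i)) * \prod_(i in C) phi u (u i))%:E <= 1)%E.
Proof.
move=> phi0 phiC phi1.
suff: forall k (D : {set 'I_n}), #|D| = k -> D \subset C ->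
    (\esum_(u in [set: {ffun 'I_n -> Z}])
      ((\prod_i p (u i)) * \prod_(i in D) phi u (u i))%:E <= 1)%E.
  by move=> /(_ _ C erefl (fintype.subxx _)).
elim=> [|k IHk] D cD DC.
  rewrite -(sample_total n); apply: le_esum => u _.
  by rewrite (cards0_eq cD) big_set0 mulr1.
have [i iD] : exists i, i \in D by apply/set0Pn; rewrite -card_gt0 cD.
have iC := fintype.subsetP DC i iD.
have {IHk} : (\esum_(u in [set: {ffun 'I_n -> Z}])
      ((\prod_i p (u i)) * \prod_(k in D :\ i) phi u (u k))%:E <= 1)%E.
  apply: IHk; first by move: (cardsD1 i D); rewrite iD cD => -[].
  exact: fintype.subset_trans (subD1set _ _) DC.
apply: le_trans.
case: n C phi phi0 phiC phi1 i D {cD DC} iD iC => [|n] C phi phi0 phiC phi1 i D iD iC.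
  by case: i iD iC.
have ge0 (u : {ffun 'I_n.+1 -> Z}) (E : {set 'I_n.+1}) :
    0 <= (\prod_i p (u i)) * \prod_(k in E) phi u (u k).
  by rewrite mulr_ge0 ?prodr_ge0.
rewrite !(esum_insert i) => [|u|u]; rewrite ?lee_fin //.
apply: le_esum => v _.
(* [c] collects all that does not involve coordinate [i]; [z0] is a placeholder there, which [phi]
   ignores because [i] is in [C]. *)
pose c := (\prod_i p (v i)) *
  \prod_(k in D :\ i) phi (insert i z0 v) (insert i z0 v k).
have c0 : 0 <= c by rewrite mulr_ge0 ?prodr_ge0.
have same z : phi (insert i z v) = phi (insert i z0 v).
  by apply: phiC => k' kC; rewrite !ffunE; case: unliftP kC => // ->; rewrite iC.
have rest z : \prod_(k in D :\ i) phi (insert i z v) (insert i z v k) =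
    \prod_(k in D :\ i) phi (insert i z0 v) (insert i z0 v k).
  apply: eq_bigr => k'; rewrite !inE => /andP[ki _]; rewrite same.
  by rewrite !ffunE; case: unliftP ki => // ->; rewrite eqxx.
have -> : (\esum_(z in [set: Z]) ((\prod_k p (insert i z v k)) *
     \prod_(k in D) phi (insert i z v) (insert i z v k))%:E =
   \esum_(z in [set: Z]) (c%:E * (p z * phi (insert i z0 v) z)%:E))%E.
  apply: eq_esum => z _; rewrite -EFinM (big_setD1 i) //= rest insert_at same.
  by rewrite prod_insert /c; congr EFin; ring.
have -> : (\esum_(z in [set: Z]) ((\prod_k p (insert i z v k)) *
     \prod_(k in D :\ i) phi (insert i z v) (insert i z v k))%:E = c%:E)%E.
  rewrite -esum_mulp //; apply: eq_esum => z _.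
  by rewrite rest prod_insert /c; congr EFin; ring.
rewrite esumZl // => [|z]; last by rewrite lee_fin mulr_ge0.
by rewrite -[leRHS]mule1 lee_wpmul2l ?lee_fin.
Qed.

End Sampling.

(** * Expectations and concentration by betting *)

Section Deviation.
Variables (R : realType) (X : choiceType) (p : X * R -> R).
Hypothesis dp : discrete_dist p.

Lemma eq_expect (g g' : X * R -> R) :
  (forall z, p z != 0 -> g z = g' z) -> expect p g = expect p g'.
Proof.
move=> gg'; have E z f f' : (p z != 0 -> f z = f' z) -> p z * f z = p z * f' z :> R.
  by have [->|_ ->] := eqVneq (p z) 0; rewrite ?mul0r.
congr (fine _ - fine _); apply: eq_esum => z _; congr EFin.
  by apply: (E z (fun z => Num.max (g z) 0) (fun z => Num.max (g' z) 0)) => /gg' ->.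
by apply: (E z (fun z => Num.max (- g z) 0) (fun z => Num.max (- g' z) 0)) => /gg' ->.
Qed.

Lemma expectN (g : X * R -> R) : expect p (fun z => - g z) = - expect p g.
Proof.
by rewrite /expect opprB; congr (_ - fine _); apply: eq_esum => z _; rewrite opprK.
Qed.

(** Finiteness matters because [fine] sends an infinite sum to a default value. *)
Lemma fine_esum_le1 (a : X * R -> R) : (forall z, 0 <= a z <= 1) ->
  exists2 r, (\esum_(z in [set: X * R]) (p z * a z)%:E = r%:E)%E & 0 <= r <= 1.
Proof.
case: dp => p0 _ p1 a01.
have le1 : (\esum_(z in [set: X * R]) (p z * a z)%:E <= 1)%E.
  rewrite -p1; apply: le_esum => z _; rewrite lee_fin.
  by have /andP[_ a1] := a01 z; rewrite ler_piMr.
have ge0 : (0 <= \esum_(z in [set: X * R]) (p z * a z)%:E)%E.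
  apply: esum_ge0 => z _; rewrite lee_fin mulr_ge0 //.
  by have /andP[] := a01 z.
by move: le1 ge0; case: (esum _ _) => [r||] //; rewrite !lee_fin => r1 r0; exists r; rewrite // r0.
Qed.

Section Bounded.
Variable g : X * R -> R.
Hypothesis g1 : forall z, `|g z| <= 1.

Lemma expect_parts : exists P N : R,
  [/\ (\esum_(z in [set: X * R]) (p z * Num.max (g z) 0)%:E = P%:E)%E,
      (\esum_(z in [set: X * R]) (p z * Num.max (- g z) 0)%:E = N%:E)%E,
      expect p g = P - N, 0 <= P <= 1 & 0 <= N <= 1].
Proof.
have [z|P eP P1] := @fine_esum_le1 (fun z => Num.max (g z) 0).
  by rewrite le_max lexx orbT ge_max ler01 andbT; have := g1 z; rewrite ler_norml => /andP[].
have [z|N eN N1] := @fine_esum_le1 (fun z => Num.max (- g z) 0).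
  rewrite le_max lexx orbT ge_max ler01 andbT; have := g1 z.
  by rewrite ler_norml lerNl => /andP[].
by exists P, N; split => //; rewrite /expect eP eN.
Qed.

Lemma norm_expect : `|expect p g| <= 1.
Proof.
have [P [N [_ _ -> /andP[P0 P1] /andP[N0 N1]]]] := expect_parts.
by rewrite ler_norml; apply/andP; split; lra.
Qed.

(** A bet on [g] at fair odds. As [g z] is within 2 of its mean, the bound on [lam] keeps the
    capital nonnegative. *)
Lemma esum_bet (lam : R) : 0 <= lam <= 1 / 4 ->
  (\esum_(z in [set: X * R]) (p z * (1 + lam * (g z - expect p g)))%:E <= 1)%E.
Proof.
move=> /andP[lam0 lam4]; case: dp => p0 _ p1.
have e1 := norm_expect.
have bet0 z : 0 <= p z * (1 + lam * (g z - expect p g)).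
  rewrite mulr_ge0 //; move: (g1 z) e1; rewrite !ler_norml.
  by move=> /andP[? ?] /andP[? ?]; nra.
have [P [N [eP eN eg /andP[P0 P1] /andP[N0 N1]]]] := expect_parts.
have m0 (x : R) : 0 <= Num.max x 0 by rewrite le_max lexx orbT.
have affine (h : X * R -> R) (r a b : R) :
    (forall z, 0 <= h z) -> 0 <= a -> 0 <= b ->
    (\esum_(z in [set: X * R]) (p z * h z)%:E = r%:E)%E ->
    (\esum_(z in [set: X * R]) (p z * (a * h z + b))%:E = (a * r + b)%:E)%E.
  move=> h0 a0 b0 hr.
  have -> : (\esum_(z in [set: X * R]) (p z * (a * h z + b))%:E =
      \esum_(z in [set: X * R]) (a%:E * (p z * h z)%:E + b%:E * (p z)%:E))%E.
    by apply: eq_esum => z _; rewrite -!EFinM -EFinD; congr EFin; ring.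
  rewrite esumD => [|z _|z _]; last 2 first.
  - by rewrite mule_ge0 ?lee_fin // mulr_ge0.
  - by rewrite mule_ge0 ?lee_fin.
  rewrite !esumZl => [||z||z]; rewrite ?lee_fin //; last by rewrite mulr_ge0.
  by rewrite hr p1 mule1 -EFinM -EFinD.
(* Moving the negative part to the left makes all summands nonnegative, so that [esumD] applies. *)
have : (\esum_(z in [set: X * R]) (p z * (1 + lam * (g z - expect p g)))%:E +
    \esum_(z in [set: X * R]) (p z * (lam * Num.max (- g z) 0 + lam * P))%:E =
    \esum_(z in [set: X * R]) (p z * (lam * Num.max (g z) 0 + (lam * N + 1)))%:E)%E.
  rewrite -esumD => [|z _|z _]; rewrite ?lee_fin //; last first.
    by rewrite mulr_ge0 // addr_ge0 // mulr_ge0.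
  apply: eq_esum => z _; rewrite -EFinD eg; congr EFin.
  have gz : g z = Num.max (g z) 0 - Num.max (- g z) 0.
    by have [h|h] := lerP (g z) 0; have [h'|h'] := lerP (- g z) 0; lra.
  by rewrite [X in lam * (X - _)]gz; ring.
rewrite (affine _ _ _ _ _ _ _ eP) // ?(affine _ _ _ _ _ _ _ eN) // ?addr_ge0 ?mulr_ge0 //.
have : (0 <= \esum_(z in [set: X * R]) (p z * (1 + lam * (g z - expect p g)))%:E)%E.
  by apply: esum_ge0 => z _; rewrite lee_fin.
case: (esum _ _) => [r||] //; rewrite !lee_fin => _ [] h.
by nra.
Qed.

End Bounded.

(** With [w = u - 2 * u ^+ 2], use [1 - w <= expR (- w)] and [(1 + u) * (1 - w) = 1 + u ^+ 2 * (1 +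
    2 * u) >= 1]. *)
Lemma expR_le_1D (u : R) : - (1 / 2) <= u -> expR (u - 2 * u ^+ 2) <= 1 + u.
Proof.
move=> u2; have h := expR_ge1Dx (- (u - 2 * u ^+ 2)).
have le1 : expR (u - 2 * u ^+ 2) * (1 - (u - 2 * u ^+ 2)) <= 1.
  by rewrite -[leRHS](expRxMexpNx_1 (u - 2 * u ^+ 2)) ler_wpM2l ?expR_ge0.
have w0 : 0 < 1 - (u - 2 * u ^+ 2) by nra.
rewrite -(ler_pM2r w0); apply: (le_trans le1).
have -> : (1 + u) * (1 - (u - 2 * u ^+ 2)) = 1 + u ^+ 2 * (1 + 2 * u) by ring.
by rewrite lerDl mulr_ge0 ?sqr_ge0 //; lra.
Qed.

(** Each factor is at least [expR (lam * x i - 8 * lam ^+ 2)], and dropping the coordinates outside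
    [C] costs at most half of [n%:R * t]. The choice [lam = t / 32] maximises
    [lam * t / 2 - 8 * lam ^+ 2], with value [t ^+ 2 / 128]. *)
Lemma prod_bet_ge n (C : {set 'I_n}) (x : 'I_n -> R) (lam t : R) :
  0 < t <= 1 -> lam = t / 32 -> (forall i, `|x i| <= 2) ->
  #|~: C|%:R * 4 <= n%:R * t -> n%:R * t <= \sum_i x i ->
  1 <= expR (- (n%:R * t ^+ 2 / 128)) * \prod_(i in C) (1 + lam * x i).
Proof.
move=> /andP[t0 t1] lamE x2 nC sx.
have lam0 : 0 < lam by rewrite lamE; lra.
have lam1 : lam <= 1 / 32 by rewrite lamE; lra.
have sC : n%:R * t / 2 <= \sum_(i in C) x i.
  have : \sum_(i in ~: C) x i <= #|~: C|%:R * 2.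
    rewrite mulr_natl -sumr_const; apply: ler_sum => i _.
    by have := x2 i; rewrite ler_norml => /andP[].
  move: sx; rewrite (bigID (mem C)) /= => sx.
  rewrite (eq_bigl (fun i => i \notin C)) => [|i]; last by rewrite inE.
  by move=> ?; lra.
have le : expR (\sum_(i in C) (lam * x i - 8 * lam ^+ 2)) <= \prod_(i in C) (1 + lam * x i).
  rewrite expR_sum; apply: ler_prod => i _; rewrite expR_ge0 /=.
  have := x2 i; rewrite ler_norml => /andP[xl xu].
  apply: le_trans (expR_le_1D _); last by nra.
  have x4 : x i ^+ 2 <= 4 by nra.
  have := ler_wpM2l (sqr_ge0 lam) x4.
  by rewrite ler_expR exprMn => ?; lra.
apply: le_trans (ler_wpM2l (expR_ge0 _) le).
rewrite -expRD -[leLHS]expR0 ler_expR sumrB -mulr_sumr sumr_const.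
have cn : #|C|%:R <= n%:R :> R by rewrite ler_nat -[leqRHS]card_ord max_card.
rewrite -[_ *+ #|C|]mulr_natl; move: (\sum_(i in C) _) sC cn => s sC cn.
have : lam * (n%:R * t / 2) <= lam * s by rewrite ler_wpM2l // ltW.
have : #|C|%:R * (8 * lam ^+ 2) <= n%:R * (8 * lam ^+ 2).
  by rewrite ler_wpM2r // mulr_ge0 // sqr_ge0.
rewrite lamE; move: (#|C|%:R) (n%:R) => c n' {cn}; nra.
Qed.

(* A betting form of Hoeffding's inequality: the product over the coordinates in
   [C q], which [g q u] does not look at, of [1 + t/32 (g q u (u i) - E (g q u))]
   has mean at most 1 but is at least [exp (n t^2/128)] on a deviation. *)
Lemma uniform_deviation (z0 : X * R) n (Q : finType) (C : Q -> {set 'I_n})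
    (g : Q -> {ffun 'I_n -> X * R} -> X * R -> R) (t : R) :
  0 < t <= 1 -> (forall q u z, `|g q u z| <= 1) ->
  (forall q (u u' : {ffun 'I_n -> X * R}),
     (forall i, i \notin C q -> u i = u' i) -> g q u = g q u') ->
  (forall q, #|~: C q|%:R * 4 <= n%:R * t) ->
  (sample_prob p [set u : {ffun 'I_n -> X * R} | exists q,
      (n%:R * t <= \sum_i (g q u (u i) - expect p (g q u)))%R]
   <= (#|Q|%:R * expR (- (n%:R * t ^+ 2 / 128)))%:E)%E.
Proof.
move=> t01 g1 gC nC; case: (dp) => p0 _ p1; have /andP[t0 t1] := t01.
pose lam := t / 32; pose c := expR (- (n%:R * t ^+ 2 / 128)).
pose phi q u z := 1 + lam * (g q u z - expect p (g q u)).
have dev q u z : `|g q u z - expect p (g q u)| <= 2.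
  by apply: le_trans (ler_normB _ _) _; rewrite (_ : 2 = 1 + 1) // lerD // norm_expect.
have phi0 q u z : 0 <= phi q u z.
  by have := dev q u z; rewrite /phi /lam ler_norml => /andP[? ?]; nra.
have terms0 q (u : {ffun 'I_n -> X * R}) : 0 <= c * ((\prod_i p (u i)) * \prod_(i in C q) phi q u (u i)).
  by rewrite mulr_ge0 ?expR_ge0 ?mulr_ge0 ?prodr_ge0.
have phi1 q : (\esum_(u in [set: {ffun 'I_n -> X * R}])
     ((\prod_i p (u i)) * \prod_(i in C q) phi q u (u i))%:E <= 1)%E.
  apply: esum_prod_le1 => // [u u' uu'|u]; first by rewrite /phi (gC q u u').
  by apply: esum_bet => //; rewrite /lam; apply/andP; split; lra.
rewrite /sample_prob esum_mkcond.
(* Markov's inequality with a union bound: on a deviation, the term of the offending [q] alone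
   exceeds the probability of [u]. *)
apply: (@le_trans _ _ (\esum_(u in [set: {ffun 'I_n -> X * R}]) \sum_(q : Q)
    (c * ((\prod_i p (u i)) * \prod_(i in C q) phi q u (u i)))%:E)%E).
  apply: le_esum => u _; rewrite sumEFin; case: ifPn => [|_]; last first.
    by rewrite lee_fin sumr_ge0.
  rewrite inE => -[q bad]; rewrite lee_fin (bigD1 q) //=.
  apply: (@le_trans _ _ (c * ((\prod_i p (u i)) * \prod_(i in C q) phi q u (u i)))).
    rewrite mulrCA ler_peMr ?prodr_ge0 //.
    exact: (@prod_bet_ge _ _ (fun i => g q u (u i) - expect p (g q u)) lam t).
  by rewrite lerDl sumr_ge0.
rewrite esum_sum => [|u q _ _]; last by rewrite lee_fin.
apply: (@le_trans _ _ (\sum_(q : Q) c%:E)%E); last first.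
  by rewrite sumEFin sumr_const mulr_natl.
apply: lee_sum => q _.
under eq_esum do rewrite EFinM.
rewrite esumZl ?expR_ge0 // => [|u]; last by rewrite lee_fin mulr_ge0 ?prodr_ge0.
by rewrite -[leRHS]mule1 lee_wpmul2l ?lee_fin ?expR_ge0.
Qed.

End Deviation.
(** * The learner *)

(** Up to samples of probability zero, [E] and [D] cover everything, and the total mass is 1. *)
Lemma sample_prob_ge (R : realType) (X : choiceType) (p : X * R -> R) n
    (E D : set {ffun 'I_n -> X * R}) (delta : R) :
  discrete_dist p ->
  (forall u : {ffun 'I_n -> X * R}, (forall i, p (u i) != 0) -> ~ D u -> E u) ->
  (sample_prob p D <= delta%:E)%E ->
  ((1 - delta)%:E <= sample_prob p E)%E.
Proof.
case=> p0 _ p1 DE Dd; rewrite EFinB leeBlDr //.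
rewrite -(sample_total p0 p1 n); apply: (@le_trans _ _ (sample_prob p E + sample_prob p D)%E).
  have P0 (u : {ffun 'I_n -> X * R}) : (0 <= (\prod_i p (u i))%:E)%E.
    by rewrite lee_fin prodr_ge0.
  rewrite /sample_prob (esum_mkcond E) (esum_mkcond D) -esumD => [|u _|u _]; last 2 first.
  - by case: ifP.
  - by case: ifP.
  apply: le_esum => u _.
  have [/existsP[i /eqP pi0]|/existsPn pn0] := boolP [exists i, p (u i) == 0].
    by rewrite (bigD1 i) //= pi0 mul0r; do 2 case: ifP => _; rewrite ?adde0.
  case: ifPn => [_|/negP nE]; first by case: ifP => _; rewrite ?adde0 // leeDl.
  case: ifPn => [_|/negP nD]; first by rewrite add0e.
  case: nE; rewrite inE; apply: DE => // Du; apply: nD; by rewrite inE.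
by rewrite leeD2l.
Qed.

Definition agreement (R : realType) (X : Type) (u v : hyp R X) (x : X) : option bool :=
  match u x, v x with
  | Some r, Some r' => if r == r' then Some (0 < r) else None
  | _, _ => None
  end.

Definition agreement_class (R : realType) (X : Type) (H1 H2 : set (hyp R X))
    (h : X -> option bool) : Prop :=
  exists u v, [/\ H1 u, H2 v & h = agreement u v].

Lemma norm_mul_sgb (R : realType) (y : R) b : `|y * sgb R b| = `|y|.
Proof. by case: b; rewrite /sgb ?mulrN ?normrN mulr1. Qed.

(** Where an agreement is defined, both of its members take the value encoded by its label, so one
    pattern serves both classes. *)
Lemma agreement_class_vc (R : realType) (X : Type) (H1 H2 : set (hyp R X)) m :
  (forall u x r, H1 u -> u x = Some r -> r = 1 \/ r = -1) ->
  mutVC H1 H2 m ->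
  forall k (x : 'I_k -> X), injective x ->
    (forall xi : 'I_k -> bool,
       exists2 h, agreement_class H1 H2 h & forall i, h (x i) = Some (xi i)) ->
    (k <= m)%N.
Proof.
move=> bin [vc _] k x xinj sh.
have both (xi : 'I_k -> bool) : exists u v, [/\ H1 u, H2 v &
    forall i, u (x i) = Some (sgb R (xi i)) /\ v (x i) = Some (sgb R (xi i))].
  have [h [u [v [Hu Hv hE]]] hxi] := sh xi; exists u, v; split => // i.
  have := hxi i; rewrite hE /agreement.
  case ux: (u (x i)) => [r|//]; case: (v (x i)) => [r'|//].
  case: eqP => [<-|//] [<-]; have [->|->] := bin _ _ _ Hu ux.
    by rewrite ltr01.
  by rewrite oppr_gt0 ltr10.
by apply: (vc k x xinj) => xi; have [u [v [Hu Hv uv]]] := both xi;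
  [exists u | exists v]; split => // i; have [] := uv i.
Qed.

Lemma thresh0_class_binary (R : realType) (X : Type) eta (S : set (hyp R X)) :
  forall u x r, thresh0_class eta S u -> u x = Some r -> r = 1 \/ r = -1.
Proof.
move=> _ x r [s Ss <-]; rewrite /thresh0; case: (s x) => // r'.
by case: ifP => _; [case=> <-; left | case: ifP => // _ [<-]; right].
Qed.

Lemma norm_gprod (R : realType) (X : Type) (B : set (hyp R X)) b x (y : R) :
  binary_class B -> B b -> `|gprod y (b x)| = `|y|.
Proof.
move=> bB Bb; rewrite /gprod; case bx: (b x) => [r|]; last by rewrite normrN normr_id.
by have [->|->] := bB _ _ _ Bb bx; rewrite ?mulrN ?normrN mulr1.
Qed.

(* Off the agreement set, [b] earns at most [eta] and the predictor loses at
   most as much; on it, both earn [|y|]. *)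
Lemma gprod_le_agreement (R : realType) (X : Type) (B : set (hyp R X)) (s b : hyp R X)
    (eta y : R) x c :
  binary_class B -> B b -> 0 <= eta -> s x = Some y ->
  (agreement (thresh0 eta s) b x = Some (0 < y) -> c = (0 < y)) ->
  gprod y (b x) - 2 * eta <= y * sgb R c.
Proof.
move=> bB Bb eta0 sx; rewrite /agreement /thresh0 sx /gprod.
have yc : - `|y| <= y * sgb R c by rewrite -(norm_mul_sgb y c) lerNnormlW.
case bx: (b x) => [r|]; last by move=> _; lra.
have := bB _ _ _ Bb bx; case: ltP => [ey|ye].
  case=> ->; rewrite ?eqxx.
    by rewrite ltr01 (le_lt_trans eta0 ey) => /(_ erefl) ->; rewrite /sgb; lra.
  by move=> _; rewrite ger0_norm in yc; lra.
case: ltP => [ey'|ye'].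
  have y0 : (0 < y) = false by apply/negbTE; rewrite -leNgt; lra.
  case=> ->.
    by move=> _; rewrite ler0_norm in yc; lra.
  by rewrite eqxx y0 oppr_gt0 ltr10 => /(_ erefl) ->; rewrite /sgb; lra.
have y1 : `|y| <= eta by rewrite ler_norml ye' ye.
move: y1; rewrite ler_norml => /andP[? ?].
by case=> -> _; case: c {yc}; rewrite /sgb; lra.
Qed.
(** [D] gathers the training indices of all [4 * l] rounds, [16 * m] for each. *)
Lemma vote_local (X : Type) (H : (X -> option bool) -> Prop) m
    (vcH : forall k (x : 'I_k -> X), injective x ->
      (forall xi : 'I_k -> bool, exists2 h, H h & forall i, h (x i) = Some (xi i)) ->
      (k <= m)%N) n l
    (s : (4 * l).-tuple ('I_(16 * m).+1 * {ffun 'I_(16 * m) -> 'I_n})) :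
  exists2 D : {set 'I_n}, (#|D| <= 64 * (l * m))%N &
    forall z z' : {ffun 'I_n -> X * bool}, (forall i, i \in D -> z i = z' i) ->
      vote vcH s z = vote vcH s z'.
Proof.
exists [set i in flatten [seq codom (a.2 : {ffun _ -> _}) | a <- s]].
  rewrite cardsE; apply: leq_trans (card_size _) _; rewrite size_flatten /shape -map_comp.
  rewrite (eq_map (g := fun=> (16 * m)%N)) => [|a] /=; last by rewrite size_codom card_ord.
  by rewrite sumnE big_map big_const_seq count_predT size_tuple iter_addn_0; lia.
move=> z z' zz'; apply: funext => x; rewrite /vote; congr (_ < 2 * _)%N.
apply: eq_in_count => a sa /=; congr weak; apply/ffunP => k; rewrite !ffunE.
apply: zz'; rewrite inE; apply/flattenP; exists (codom (a.2 : {ffun _ -> _})).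
  by apply/mapP; exists a.
exact: codom_f.
Qed.

(** Three errors of [eps / 3] add up: the choice of a near-optimal [b], the deviation of [b], and
    that of the chosen vote. Taking [t = eps / 3] gives [1152 = 128 * 9] and [768 = 64 * 4 * 3]; the
    successor in the count accounts for [b]. *)
Lemma vote_learner (R : realType) (X : choiceType) (S B : set (hyp R X)) (eta eps delta : R)
    (m n l : nat) (x0 : X) :
  binary_class B -> 0 <= eta -> 0 < eps < 1 ->
  mutVC (thresh0_class eta S) B m ->
  (0 < n)%N -> (n < 2 ^ l)%N -> (768 * (l * m))%:R <= n%:R * eps ->
  (((16 * m).+1 * n ^ (16 * m)) ^ (4 * l)).+1%:R * expR (- (n%:R * eps ^+ 2 / 1152)) <= delta ->
  exists L : learner R X n, DCorM S B (eps + 2 * eta) delta L.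
Proof.
move=> bB eta0 /andP[eps0 eps1] vc n0 nl small union.
have vcH := agreement_class_vc (@thresh0_class_binary _ _ eta S) vc.
pose Q : finType := (4 * l).-tuple ('I_(16 * m).+1 * {ffun 'I_(16 * m) -> 'I_n}).
pose lab (u : {ffun 'I_n -> X * R}) := [ffun i => ((u i).1, 0 < (u i).2)].
pose f (q : Q) (u : {ffun 'I_n -> X * R}) (x : X) := vote vcH q (lab u) x.
pose emp (u : {ffun 'I_n -> X * R}) (q : Q) := \sum_i (u i).2 * sgb R (f q u (u i).1).
have q0 : Q by exact: nseq_tuple (ord0, [ffun=> Ordinal n0]).
pose best (u : {ffun 'I_n -> X * R}) := [arg max_(q > q0) emp u q]%O.
exists (fun u => f (best u) u) => p dp [s [Ss sp]].
set sup := ereal_sup _.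
have [p0 pI p1] := dp.
have Eb b : B b -> `|expect p (fun z => gprod z.2 (b z.1))| <= 1.
  move=> Bb; rewrite (@eq_expect _ _ _ _
    (fun z => if `|z.2| <= 1 then gprod z.2 (b z.1) else 0)) => [|z /pI]; last first.
    by rewrite -ler_norml => ->.
  by apply: norm_expect => // z; case: ifP; rewrite ?normr0 // (norm_gprod _ _ bB Bb).

have dlt0 : 0 <= delta by apply: le_trans union; rewrite mulr_ge0 ?expR_ge0.
have [[b0 Bb0]|nB] := pselect (exists b, B b); last first.
  have supE : sup = -oo%E.
    rewrite /sup (_ : [set _ | b in B] = set0) ?ereal_sup0 //.
    by apply/seteqP; split => // r [b Bb]; case: nB; exists b.
  apply: (@sample_prob_ge _ _ _ _ _ set0) => //; last by rewrite /sample_prob esum_set0 lee_fin.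
  by move=> u _ _ /=; rewrite supE leNye.
have supfin : sup \is a fin_num.
  have le1 : (sup <= 1)%E.
    apply: ge_ereal_sup => _ [b Bb <-]; rewrite lee_fin.
    by have := Eb b Bb; rewrite ler_norml => /andP[].
  have ge1 : ((expect p (fun z => gprod z.2 (b0 z.1)))%:E <= sup)%E.
    by apply: ereal_sup_ubound; exists b0.
  by rewrite fin_numElt (lt_le_trans _ ge1) ?ltNyr // (le_lt_trans le1) ?ltry.
have eps3 : 0 < eps / 3 by lra.
have [_ [b Bb <-] bsup] := ub_ereal_sup_adherent eps3 supfin.
(* The sign turns an upper deviation of [gb] into a lower one for [b]. The cutoff bounds the
   function everywhere and is invisible to [p]. *)
pose gb (z : X * R) := if `|z.2| <= 1 then - gprod z.2 (b z.1) else 0.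
pose gq (q : Q) (u : {ffun 'I_n -> X * R}) (z : X * R) := if `|z.2| <= 1 then z.2 * sgb R (f q u z.1) else 0.
pose g (q : option Q) (u : {ffun 'I_n -> X * R}) := if q is Some q then gq q u else gb.
have [D DP] := choice (fun q : Q => let: ex_intro2 D cD DE := vote_local vcH q in
  ex_intro (fun D : {set 'I_n} => _ /\ _) D (conj cD DE)).
(* A vote is tested on the coordinates it is not built from; [b] does not depend on the sample and
   is tested on all. *)
pose C (q : option Q) := ~: (if q is Some q then D q else finset.set0).
have labE (u u' : {ffun 'I_n -> X * R}) (A : {set 'I_n}) : (forall i, i \in A -> u i = u' i) ->
    forall i, i \in A -> lab u i = lab u' i.
  by move=> uu' i iD; rewrite !ffunE uu'.
have t01 : 0 < eps / 3 <= 1 by rewrite eps3 /=; lra.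
have g1 q u z : `|g q u z| <= 1.
  case: q => [q|] /=; rewrite /gq /gb; case: ifP; rewrite ?normr0 //.
    by rewrite norm_mul_sgb.
  by rewrite normrN (norm_gprod _ _ bB Bb).
have gC q (u u' : {ffun 'I_n -> X * R}) :
    (forall i, i \notin C q -> u i = u' i) -> g q u = g q u'.
  case: q => [q|] // uu'; apply: funext => z /=.
  rewrite /gq /f; congr (if _ then _ * sgb _ (_ z.1) else _).
  apply: (DP q).2; apply: labE => i iD.
  by apply: uu'; rewrite inE negbK.
have nC q : #|~: C q|%:R * 4 <= n%:R * (eps / 3).
  rewrite /C finset.setCK; case: q => [q|]; last by rewrite cards0 mul0r mulr_ge0 // ltW.
  have [cD _] := DP q; rewrite mulrA ler_pdivlMr //; apply: le_trans small.
  by rewrite -!natrM ler_nat; lia.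
have := uniform_deviation dp (x0, 0) t01 g1 gC nC.
set dev := [set u | _] => devD.
apply: (@sample_prob_ge _ _ _ _ _ dev) => // [u supp nD|]; last first.
  apply: le_trans devD _; rewrite lee_fin; apply: le_trans union.
  rewrite card_option card_tuple card_prod card_ffun !card_ord.
  by rewrite ler_wpM2l // ler_expR lerN2 exprMn; lra.
have good q : \sum_i (g q u (u i) - expect p (g q u)) < n%:R * (eps / 3).
  by rewrite ltNge; apply/negP => bad; apply: nD; exists q.
have uy i : `|(u i).2| <= 1 by rewrite ler_norml pI.
have n0' : 0 < n%:R :> R by rewrite ltr0n.
have goodb : n%:R * expect p (fun z => gprod z.2 (b z.1)) - n%:R * (eps / 3) <
    \sum_i gprod (u i).2 (b (u i).1).
  have := good None; rewrite /= sumrB sumr_const card_ord -[_ *+ n]mulr_natl.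
  have -> : expect p gb = - expect p (fun z => gprod z.2 (b z.1)).
    by rewrite -expectN; apply: eq_expect => z /pI; rewrite /gb -ler_norml => ->.
  rewrite (eq_bigr (fun i => - gprod (u i).2 (b (u i).1))) => [|i _]; last first.
    by rewrite /gb uy.
  by rewrite sumrN; lra.
have goodf q : emp u q - n%:R * (eps / 3) < n%:R * expect p (fun z => z.2 * sgb R (f q u z.1)).
  have := good (Some q); rewrite /= sumrB sumr_const card_ord -[_ *+ n]mulr_natl.
  have -> : expect p (gq q u) = expect p (fun z => z.2 * sgb R (f q u z.1)).
    by apply: eq_expect => z /pI; rewrite /gq -ler_norml => ->.
  rewrite (eq_bigr (fun i => (u i).2 * sgb R (f q u (u i).1))) => [|i _]; last first.
    by rewrite /gq uy.
  by rewrite -/(emp u q); lra.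
have [q qP] := vote_consistent vcH (lab u) (ex_intro _ _ (ex_intro _ _ (And3
  (ex_intro2 _ _ s Ss erefl) Bb erefl))) n0 nl.
have empb : \sum_i gprod (u i).2 (b (u i).1) - n%:R * (2 * eta) <= emp u q.
  rewrite mulr_natl -[X in _ *+ X]card_ord -sumr_const -sumrB; apply: ler_sum => i _.
  apply: (gprod_le_agreement bB Bb eta0 (sp _ (supp i))).
  by have := qP i; rewrite ffunE.
have empq : emp u q <= emp u (best u).
  by rewrite /best; case: arg_maxP => // q' _; apply.
have := goodf (best u); move: bsup; rewrite -/sup /= -[sup]fineK // -!EFinB lte_fin lee_fin.
move: (fine sup) (expect _ _) (expect p (fun z => z.2 * _)) goodb empb empq => v Eb' Ef.
move: (\sum_i _) (emp u q) (emp u (best u)) => e1 e2 e3 h1 h2 h3 h4 h5.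
have : n%:R * (Eb' - eps / 3 - 2 * eta - eps / 3) < n%:R * Ef by lra.
by rewrite ltr_pM2l //; lra.
Qed.
(** * The sample size *)

Lemma sqr_lt_exp2 k : (4 < k)%N -> (k ^ 2 < 2 ^ k)%N.
Proof.
elim: k => // k IHk; rewrite ltnS leq_eqVlt => /predU1P[<- //|k4].
by have := IHk k4; rewrite !expnS; nia.
Qed.

(** The constant is a square because a root is taken in [mul_sqr_le]. The inductive step squares
    [5 * (v + 1) ^ 2 <= 7 * v ^ 2], using [49 <= 50]. *)
Lemma exp4_le_exp2 v : (v ^ 4 <= 25 * 2 ^ v)%N.
Proof.
have [|v7] := leqP v 6; first by move: v; do 7 case => //.
elim: v v7 => // v IHv; rewrite ltnS leq_eqVlt => /predU1P[<- //|v6].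
have := IHv v6; rewrite (expnS 2) => IH.
suff : (v.+1 ^ 4 <= 2 * v ^ 4)%N by lia.
have : (5 * v.+1 ^ 2 <= 7 * v ^ 2)%N by rewrite !expnS !expn0; nia.
rewrite -[4%N]/(2 * 2)%N !expnM; move: (_ ^ 2)%N (_ ^ 2)%N => a b ab.
by rewrite !expnS !expn0; nia.
Qed.

(* If [v <= 2 u] the first term suffices; otherwise [m ^ 2 <= 2 ^ v]. *)
Lemma mul_sqr_le m u v : (m <= 2 ^ u)%N -> (m * v ^ 2 <= 4 * (m * u ^ 2) + 5 * 2 ^ v)%N.
Proof.
move=> mu; have [vu|uv] := leqP v (2 * u).
  apply: leq_trans (leq_addr _ _); rewrite mulnCA leq_mul2l; apply/orP; right.
  by rewrite -[4%N]/(2 ^ 2)%N -expnMn leq_sqr.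
apply: leq_trans (leq_addl _ _); rewrite -leq_sqr !expnMn -expnM.
have m2 : (m ^ 2 <= 2 ^ v)%N.
  apply: (@leq_trans ((2 ^ u) ^ 2)%N); first by rewrite leq_sqr.
  by rewrite -expnM leq_exp2l //; lia.
rewrite -expnD expnM -(mulnn (2 ^ v)) [leqRHS]mulnCA.
exact: leq_mul m2 (exp4_le_exp2 v).
Qed.

(** Exponents of powers of two stand in for logarithms, so that size estimates can run in [nat]. *)
Lemma next_pow2 (R : realType) (x : R) :
  exists u : nat, x <= 2 ^+ u /\ (u = 0%N \/ 2 ^+ u < 2 * x).
Proof.
have ex : exists u : nat, x <= 2 ^+ u.
  exists (Num.truncn x).+1; apply: ltW; apply: lt_le_trans (truncnS_gt x) _.
  by rewrite -natrX ler_nat ltnW // ltn_expl.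
exists (ex_minn ex); case: ex_minnP => -[|u] xu umin; split => //; [by left | right].
have : ~~ (x <= 2 ^+ u) by apply/negP => /umin; rewrite ltnn.
by rewrite -ltNge exprS ltr_pM2l.
Qed.

Lemma ln2_ge (R : realType) : 1 / 2 <= ln 2 :> R.
Proof.
have : ln (1 + - (1 / 2) : R) <= - (1 / 2) by apply: le_ln1Dx; lra.
rewrite (_ : 1 + - (1 / 2) = 2^-1 :> R); last by lra.
by rewrite lnV ?posrE //; lra.
Qed.

Lemma logp_ge1 (R : realType) (x : R) : 1 <= logp x.
Proof.
have ln20 : 0 < ln 2 :> R by apply: lt_le_trans (ln2_ge R); lra.
by rewrite /logp ler_pdivlMr // mul1r ler_ln ?posrE ?lt_max ?ltr0n // le_max lexx.
Qed.

Lemma le_2logp (R : realType) (x : R) u : 2 ^+ u < 2 * x -> u%:R <= 2 * logp x.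
Proof.
move=> ux; have ln20 : 0 < ln 2 :> R by apply: lt_le_trans (ln2_ge R); lra.
have x0 : 0 < x by rewrite -(@pmulr_rgt0 _ 2) // (le_lt_trans _ ux) // exprn_ge0.
have : ln (2 ^+ u) <= ln (2 * x) by rewrite ler_ln ?posrE ?exprn_gt0 ?mulr_gt0 // ltW.
rewrite lnXn // lnM ?posrE // => h.
have h' : ln x <= ln (Num.max 2 x) by rewrite ler_ln ?posrE ?lt_max ?x0 ?orbT // le_max lexx orbT.
have : u%:R <= 1 + logp x.
  rewrite /logp -[X in X + _](@mulfV _ (ln 2)) ?gt_eqF // -mulrDl ler_pdivlMr //.
  by rewrite mulr_natl; lra.
by have := logp_ge1 x; lra.
Qed.

(** For [m > 0], both [16 * m + 1] and [n] are at most [2 ^ l], and [4 * (16 * m + 1) <= 68 * m].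
    For [m = 0] the count is 1. *)
Lemma vote_count_le m n l : (0 < m -> 16 * m < n)%N -> (n < 2 ^ l)%N ->
  (((16 * m).+1 * n ^ (16 * m)) ^ (4 * l) <= 2 ^ (68 * (m * l ^ 2)))%N.
Proof.
case: m => [|m] mn nl; first by rewrite muln0 expn0 muln1 exp1n.
have nm := mn isT.
apply: (@leq_trans ((2 ^ l * (2 ^ l) ^ (16 * m.+1)) ^ (4 * l))%N).
  rewrite leq_exp2r ?leq_mul //; last 1 first.
  - by case: l nl => [|//]; rewrite expn0; lia.
  - exact: ltnW (leq_ltn_trans nm nl).
  by rewrite leq_exp2r // ltnW.
rewrite -expnS -!expnM leq_exp2l // expnS expn1.
by have := leq0n (m * (l * l)); nia.
Qed.

Lemma union_bound_le (R : realType) (m n l : nat) (eps delta : R) :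
  (0 < m -> 16 * m < n)%N -> (n < 2 ^ l)%N -> 0 < delta ->
  1 + 128 * (m * l ^ 2)%:R + ln (1 / delta) <= n%:R * eps ^+ 2 / 1152 ->
  (((16 * m).+1 * n ^ (16 * m)) ^ (4 * l)).+1%:R * expR (- (n%:R * eps ^+ 2 / 1152)) <= delta.
Proof.
move=> mn nl d0 big; set N := (68 * (m * l ^ 2))%N.
have two_le : 2 <= expR 1 :> R by have := expR_ge1Dx (1 : R); lra.
have cnt : (((16 * m).+1 * n ^ (16 * m)) ^ (4 * l)).+1%:R <= expR N.+1%:R :> R.
  apply: (@le_trans _ _ ((2 ^ N.+1)%:R)).
    rewrite ler_nat expnS; have := vote_count_le mn nl; rewrite -/N.
    by have : (0 < 2 ^ N)%N by [rewrite expn_gt0]; lia.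
  rewrite natrX -[N.+1%:R]mulr1 expRM_natl; by rewrite lerXn2r ?nnegrE ?expR_ge0.
apply: (le_trans (ler_wpM2r (expR_ge0 _) cnt)).
rewrite -expRD -[leRHS]lnK ?posrE // ler_expR.
have : ln (1 / delta) = - ln delta by rewrite div1r lnV.
move=> eL; move: big; rewrite eL -natr1 /N natrM.
by have : 0 <= (m * l ^ 2)%:R :> R by []; lra.
Qed.

(** The sample size grows with [m * l ^ 2] yet must stay below [2 ^ l]. With [l = 2 * k], one factor
    [2 ^ k] absorbs [k ^ 2]; the other absorbs [2 ^ v], three factors [2 ^ u] (two for
    [1 / eps ^+ 2], one for [m]) and the constants, through [2 ^ 21 = 2048 * 1024]. *)
Lemma sample_size_lt_exp m u v k y :
  (m <= 2 ^ u)%N -> k = (21 + 3 * u + v)%N ->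
  (y <= 1153 * (2 ^ u) ^ 2 * (1 + 128 * (m * (2 * k) ^ 2) + 2 ^ v))%N ->
  (y < 2 ^ (2 * k))%N.
Proof.
move=> mu kE /leq_ltn_trans; apply.
have k2 : (k ^ 2 < 2 ^ k)%N by apply: sqr_lt_exp2; lia.
rewrite (_ : 2 ^ (2 * k) = 2 ^ k * 2 ^ k)%N; last by rewrite mul2n -addnn expnD.
apply: leq_ltn_trans (_ : 2 ^ k * k ^ 2 < _)%N; last first.
  by rewrite ltn_pmul2l // expn_gt0.
have kk : (21 <= k)%N by lia.
have -> : (2 ^ k = 2048 * 1024 * (2 ^ u) ^ 3 * 2 ^ v)%N.
  by rewrite kE (expnD _ _ v) (expnD _ 21%N) (mulnC 3%N) expnM (expnD 2 11 10).
move: mu.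
have : (0 < 2 ^ u)%N by rewrite expn_gt0.
have : (0 < 2 ^ v)%N by rewrite expn_gt0.
move: (2 ^ u)%N (2 ^ v)%N => U V V0 U0 mu; have k1 : (1 <= k ^ 2)%N by rewrite expn_gt0; lia.
have h : (m * k ^ 2 <= U * V * k ^ 2)%N by rewrite leq_mul2r; apply/orP; right; nia.
have h' : (1 + V <= 2 * (U * V * k ^ 2))%N.
  apply: (@leq_trans (2 * (1 * V * 1))%N); first by lia.
  by rewrite leq_mul2l /= !leq_mul.
have : (1 + 128 * (m * (2 * k) ^ 2) + V <= 1024 * (U * V * k ^ 2))%N.
  by rewrite expnMn -[(2 ^ 2)%N]/4%N; move: (k ^ 2)%N h h' => K h h'; lia.
move: (k ^ 2)%N => K; move: (1 + _ + V)%N => A hA.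
apply: (@leq_trans (1153 * U ^ 2 * (1024 * (U * V * K)))%N); first by rewrite leq_mul2l hA orbT.
rewrite (_ : (2048 * 1024 * U ^ 3 * V * K = 2048 * (U ^ 2) * (1024 * (U * V * K)))%N).
  by rewrite !leq_mul.
by rewrite [(U ^ 3)%N]expnS; move: (U ^ 2)%N => U2; lia.
Qed.

Lemma sample_size (R : realType) (m : nat) (eps delta : R) :
  0 < eps < 1 / 2 -> 0 < delta < 1 / 2 ->
  exists n l : nat,
    [/\ (0 < n)%N, (n < 2 ^ l)%N, (768 * (l * m))%:R <= n%:R * eps,
        (((16 * m).+1 * n ^ (16 * m)) ^ (4 * l)).+1%:R *
          expR (- (n%:R * eps ^+ 2 / 1152)) <= delta &
        n%:R <= 10 ^+ 9 * (m%:R / eps ^+ 2 * logp (m%:R / eps) ^+ 2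
                           + 1 / eps ^+ 2 * ln (1 / delta))].
Proof.
move=> /andP[e0 e2] /andP[d0 d2]; set L := ln (1 / delta).
have L2 : 1 / 2 <= L.
  apply: le_trans (ln2_ge R) _; rewrite /L ler_ln ?posrE // ?divr_gt0 //.
  by rewrite ler_pdivlMr //; lra.
set P := logp (m%:R / eps); have P1 : 1 <= P by exact: logp_ge1.
have [u [mu uP]] := next_pow2 (m%:R / eps : R).
have [v [Lv vL]] := next_pow2 L.
pose k := (21 + 3 * u + v)%N; pose W l := (m * l ^ 2)%N.
(* The size at which the hypothesis of [union_bound_le] holds with equality; rounding up turns 1152
   into 1153 in [Nle]. *)
pose y l : R := 1152 / eps ^+ 2 * (1 + 128 * (W l)%:R + L).
pose N l := (Num.truncn (y l)).+1.
have eps20 : 0 < eps ^+ 2 by rewrite exprn_gt0.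
have ie1 : 1 <= (eps ^+ 2)^-1 by rewrite -[leLHS]invr1 lef_pV2 ?posrE //; nra.
have y0 l : 0 <= y l.
  have : 0 <= (W l)%:R :> R by [].
  move=> W0; have : 0 <= (eps ^+ 2)^-1 * (1 + 128 * (W l)%:R + L) by rewrite mulr_ge0; lra.
  by rewrite /y; lra.
have Ngt l : y l < (N l)%:R by exact: truncnS_gt.
have Nle l : (N l)%:R <= 1153 / eps ^+ 2 * (1 + 128 * (W l)%:R + L).
  have := truncn_itv (y0 l) => /andP[h _]; rewrite /N -natr1.
  apply: le_trans (lerD h (lexx 1)) _; rewrite /y.
  have : 0 <= (W l)%:R :> R by [].
  by move: (W l)%:R (eps ^+ 2)^-1 ie1 => w e h1 h2; nra.
have Nbig l : 1 + 128 * (W l)%:R + L <= (N l)%:R * eps ^+ 2 / 1152.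
  have := ltW (Ngt l); rewrite -(ler_pM2r eps20).
  have -> : y l * eps ^+ 2 = 1152 * (1 + 128 * (W l)%:R + L).
    by rewrite /y mulrAC divfK ?gt_eqF.
  by lra.
have Nm l : (0 < W l)%N || (m == 0)%N -> (0 < m -> 16 * m < N l)%N.
  move=> Wl m0; rewrite -(ltr_nat R); apply: le_lt_trans (Ngt l).
  have Wm : (m <= W l)%N.
    by move: Wl; rewrite /W muln_gt0 m0 (gtn_eqF m0) orbF /= => l0; rewrite leq_pmulr.
  have : m%:R <= (W l)%:R :> R by rewrite ler_nat.
  have : 0 <= m%:R :> R by [].
  rewrite /y natrM; move: (W l)%:R (eps ^+ 2)^-1 ie1 => w e h1 h2; nra.
have Nsmall l : (768 * (l * m))%:R <= (N l)%:R * eps.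
  have lW : (l * m <= W l)%N.
    have ll : (l <= l ^ 2)%N by rewrite -mulnn; case: (l) => // j; apply: leq_pmulr.
    by rewrite /W mulnC leq_mul.
  have lW' : (l * m)%:R <= (W l)%:R :> R by rewrite ler_nat.
  have := ltW (Ngt l); rewrite -(ler_pM2r e0) natrM.
  have -> : y l * eps = 1152 * (eps^-1 * (1 + 128 * (W l)%:R + L)).
    rewrite /y expr2 invfM; set A := _ + _ + L; set B := eps^-1.
    by rewrite -!mulrA [A * eps]mulrC [B * (eps * A)]mulrA mulVf ?gt_eqF // mul1r.
  have ie2 : 1 <= eps^-1 by rewrite -[leLHS]invr1 lef_pV2 ?posrE //; lra.
  have a0 : 0 <= (l * m)%:R :> R by [].
  have : 1 * (1 + 128 * (W l)%:R + L) <= eps^-1 * (1 + 128 * (W l)%:R + L).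
    by apply: ler_wpM2r ie2; lra.
  by lra.
have e2i0 : 0 <= (eps ^+ 2)^-1 by lra.
(* For [m = 0] the size does not depend on [l], so it can serve as [l] itself. *)
have [m0|m0] := posnP m.
  exists (N 0), (N 0); split => //; first exact: ltn_expl.
  - by rewrite m0 muln0 mulr_ge0 // ltW.
  - apply: union_bound_le => //; [by rewrite m0 | exact: ltn_expl |].
    by have := Nbig 0; rewrite /W m0 !mul0n.
  apply: (le_trans (Nle 0)); rewrite /W m0 mul0n !mul0r add0r.
  by move: (eps ^+ 2)^-1 e2i0 => e h; nra.
have k0 : (0 < W (2 * k))%N by rewrite /W muln_gt0 m0 expn_gt0 muln_gt0.
have mr1 : 1 <= m%:R :> R by rewrite ler1n.
have em : eps^-1 <= m%:R / eps by rewrite ler_peMl // invr_ge0 ltW.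
have mu' : (m <= 2 ^ u)%N.
  rewrite -(ler_nat R) natrX; apply: le_trans mu.
  by rewrite ler_pdivlMr // ler_piMr //; lra.
(* With [a = m * P ^ 2], one has [m * u ^ 2 <= 4 * a] and [m * v ^ 2 <= 16 * a + 10 * L], whence
   [5916 = 12 * (441 + 36 + 16)] and [120 = 12 * 10]. *)
have Wle : (W (2 * k))%:R <= 5916 * (m%:R * P ^+ 2) + 120 * L.
  have uP2 : u%:R ^+ 2 <= 4 * P ^+ 2.
    case: uP => [->|/le_2logp h]; first by rewrite expr2 mul0r mulr_ge0 // sqr_ge0.
    by rewrite -/P in h; have : 0 <= u%:R :> R by []; nra.
  have vL2 : 2 ^+ v <= 2 * L by case: vL => [->|/ltW //]; rewrite expr0; lra.
  have mv : m%:R * v%:R ^+ 2 <= 4 * (m%:R * u%:R ^+ 2) + 5 * 2 ^+ v :> R.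
    by rewrite -!natrX -!natrM -natrD ler_nat mul_sqr_le.
  have k3 : k%:R ^+ 2 <= 3 * (441 + 9 * u%:R ^+ 2 + v%:R ^+ 2) :> R.
    rewrite /k (natrD _ _ v) (natrD _ 21%N) natrM; move: u%:R v%:R => a b.
    by have := sqr_ge0 (21 - 3 * a); have := sqr_ge0 (21 - b); have := sqr_ge0 (3 * a - b); lra.
  have : m%:R * k%:R ^+ 2 <= m%:R * (3 * (441 + 9 * u%:R ^+ 2 + v%:R ^+ 2)) :> R.
    by rewrite ler_wpM2l.
  rewrite /W natrM natrX natrM exprMn.
  have : m%:R * u%:R ^+ 2 <= m%:R * (4 * P ^+ 2) by rewrite ler_wpM2l.
  have : m%:R <= m%:R * P ^+ 2 by rewrite ler_peMr //; nra.
  by lra.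
have Nl : (N (2 * k)%N < 2 ^ (2 * k))%N.
  apply: (sample_size_lt_exp (u := u) (v := v) mu' erefl).
  rewrite -(ler_nat R); apply: (le_trans (Nle _)); rewrite -/(W (2 * k)).
  rewrite natrM (natrM _ 1153) natrD (natrD _ 1%N) (natrM _ 128) !natrX.
  have ieU : (eps ^+ 2)^-1 <= (2 ^+ u) ^+ 2.
    by rewrite -exprVn lerXn2r ?nnegrE ?invr_ge0 ?exprn_ge0 ?(ltW e0) ?(le_trans em mu).
  have AA' : 1 + 128 * (W (2 * k)%N)%:R + L <= 1 + 128 * (W (2 * k)%N)%:R + 2 ^+ v.
    by rewrite lerD2l.
  have A0 : 0 <= 1 + 128 * (W (2 * k)%N)%:R + L.
    by have : 0 <= (W (2 * k)%N)%:R :> R by []; lra.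
  have := ler_pM e2i0 A0 ieU AA'.
  move: (1 + 128 * (W (2 * k)%N)%:R + L) (1 + 128 * (W (2 * k)%N)%:R + 2 ^+ v).
  move=> A A'; move: (eps ^+ 2)^-1 ((2 ^+ u) ^+ 2) => e U2.
  by move=> h; rewrite -!mulrA; apply: ler_wpM2l h; apply: ler0n.
exists (N (2 * k)%N), (2 * k)%N; split => //.
  by apply: union_bound_le (Nbig _) => //; apply: Nm; rewrite k0.
apply: (le_trans (Nle _)).
have : 0 <= m%:R * P ^+ 2 by rewrite mulr_ge0 // sqr_ge0.
rewrite (_ : m%:R / eps ^+ 2 * P ^+ 2 = m%:R * P ^+ 2 / eps ^+ 2); last by rewrite mulrAC.
move: (m%:R * P ^+ 2) (W _)%:R Wle (eps ^+ 2)^-1 e2i0 => a w wa e he a0.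
(* The summand 1 is at most [2 * L], and [1153 * 128 * 5916 < 10 ^ 9]. *)
have : 1153 * (1 + 128 * w + L) <= 10 ^+ 9 * (a + L) by lra.
by nra.
Qed.

Theorem theorem4p6 (R : realType) :
  exists C : R, 0 < C /\
  forall (X : choiceType) (S B : set (hyp R X)) (eta eps delta : R) (m : nat),
    (exists x : X, True) -> real_class S -> binary_class B ->
    0 <= eta -> 0 < eps < 1/2 -> 0 < delta < 1/2 ->
    mutVC (thresh0_class eta S) B m ->
    exists (n : nat) (L : learner R X n),
      DCorM S B (eps + 2 * eta) delta L /\
      n%:R <= C * (m%:R / eps ^+ 2 * logp (m%:R / eps) ^+ 2
                   + 1 / eps ^+ 2 * ln (1 / delta)).
Proof.
exists (10 ^+ 9); split; first by rewrite exprn_gt0.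
move=> X S B eta eps delta m [x _] _ bB eta0 eps01 delta01 vc.
have [n [l [n0 nl small union bound]]] := sample_size m eps01 delta01.
have eps1 : 0 < eps < 1 by case/andP: eps01 => -> ?; lra.
by have [L LP] := vote_learner x bB eta0 eps1 vc n0 nl small union; exists n, L.
Qed.
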